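(* There exist positive integers $m,n$, three distinct positions $(r_a,c_a),(r_b,c_b),(r_c,c_c)\in\{1,\dots,m\}\times\{1,\dots,n\}$, and a constant-size (i.e. fixed finite) system $\mathcal{S}$ of affine constraints with rational data $\langle A_\ell,X\rangle=b_\ell$ on a matrix $X\in\mathbb{R}^{m\times n}$ such that, writing $a=X_{r_a,c_a}$, $b=X_{r_b,c_b}$, $c=X_{r_c,c_c}$ for the designated entries of $X$, the following hold. (Soundness) If $X\in\mathbb{R}^{m\times n}$ satisfies all constraints of $\mathcal{S}$ and $\operatorname{rank}(X)\le 3$, then $c=ab$. (Completeness) For any real numbers $a,b,c$ satisfying $c=ab$, there exists $X\in\mathbb{R}^{m\times n}$ with $\operatorname{rank}(X)\le 3$ satisfying all constraints of $\mathcal{S}$ and whose designated entries are $X_{r_a,c_a}=a$, $X_{r_b,c_b}=b$, $X_{r_c,c_c}=c$.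
   Context: For $A,X\in\mathbb{R}^{m\times n}$, $\langle A,X\rangle=\sum_{i,j}A_{ij}X_{ij}$. An affine constraint on $X$ is an equation $\langle A,X\rangle=b$ with $A\in\mathbb{Q}^{m\times n}$, $b\in\mathbb{Q}$. A designated entry is an entry of $X$ at a fixed position, whose value represents a real scalar. *)

(* Defs.v *)
(* Mathematical Components, with the real numbers of MathComp-Analysis. *)
From HB Require Import structures.
From mathcomp Require Import all_boot all_order all_algebra.
From mathcomp Require Import reals.

Set Implicit Arguments.
Unset Strict Implicit.
Unset Printing Implicit Defensive.

Import GRing.Theory.
Local Open Scope ring_scope.

Definition mxinner (R : realType) (m n : nat) (A X : 'M[R]_(m, n)) : R :=
  \sum_(i < m) \sum_(j < n) A i j * X i j.

(* The pair (A, b) stands for the equation <A, X> = b. *)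
Definition affine_constraint (m n : nat) := ('M[rat]_(m, n) * rat)%type.

Definition satisfies (R : realType) (m n : nat) (X : 'M[R]_(m, n))
    (l : affine_constraint m n) : Prop :=
  mxinner (map_mx ratr l.1) X = ratr l.2.

Definition satisfies_all (R : realType) (m n : nat)
    (S : seq (affine_constraint m n)) (X : 'M[R]_(m, n)) : Prop :=
  forall l, l \in S -> satisfies X l.

Definition entry (R : realType) (m n : nat) (X : 'M[R]_(m, n))
    (p : 'I_m * 'I_n) : R := X p.1 p.2.

(* Main.v *)
(* Fixing all entries but three, [X] becomes the block-diagonal sum of
   [[1, a], [b, c]] and the 2x2 identity.  Its rank is 2 plus the rank of the
   first block, hence at most 3 exactly when [c - ab = 0]. *)
Require Import Defs.
From HB Require Import structures.
From mathcomp Require Import all_boot all_order all_algebra.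
From mathcomp Require Import reals.

Set Implicit Arguments.
Unset Strict Implicit.
Unset Printing Implicit Defensive.

Import GRing.Theory.
Local Open Scope ring_scope.

Lemma mxinner_delta (R : realType) (m n : nat) (i : 'I_m) (j : 'I_n)
    (X : 'M[R]_(m, n)) :
  mxinner (map_mx ratr (delta_mx i j)) X = X i j.
Proof.
rewrite /mxinner (bigD1 i) //= (bigD1 j) //= !mxE !eqxx rmorph1 mul1r.
rewrite big1 => [|l jl]; last by rewrite !mxE (negPf jl) andbF rmorph0 mul0r.
rewrite big1 => [|k ik]; last first.
  by apply: big1 => l _; rewrite !mxE (negPf ik) rmorph0 mul0r.
by rewrite !addr0.
Qed.

(** Elementary matrices as coefficients make each equation fix a single entry, with rational
    data. *)
Definition prescribe (m n : nat) (T : 'M[rat]_(m, n))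
    (F : pred ('I_m * 'I_n)) : seq (affine_constraint m n) :=
  [seq (delta_mx p.1 p.2, T p.1 p.2) | p <- enum F].

Lemma satisfies_prescribe (R : realType) (m n : nat) (T : 'M[rat]_(m, n))
    (F : pred ('I_m * 'I_n)) (X : 'M[R]_(m, n)) :
  satisfies_all (prescribe T F) X <->
  forall i j, F (i, j) -> X i j = ratr (T i j).
Proof.
split=> [SX i j Fij | XT l /mapP[[i j]]].
  have /SX : (delta_mx i j, T i j) \in prescribe T F.
    by apply/mapP; exists (i, j); rewrite ?mem_enum.
  by rewrite /satisfies mxinner_delta.
by rewrite mem_enum => Fij ->; rewrite /satisfies mxinner_delta XT.
Qed.

(** Over a field, a nonzero determinant makes [A] invertible, hence of full rank. This turns the
    rank bound into a polynomial equation in the entries. *)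
Lemma mxrank_lt_det0 (K : fieldType) (n : nat) (A : 'M[K]_n) :
  (\rank A < n)%N -> \det A = 0.
Proof.
move=> rA; apply/eqP; apply: contraTT rA => dA.
by rewrite -leqNgt mxrank_unit // unitmxE unitfE.
Qed.

Lemma det_mx2 (K : comNzRingType) (A : 'M[K]_2) :
  \det A = A 0 0 * A 1 1 - A 0 1 * A 1 0.
Proof.
rewrite (expand_det_row _ 0) big_ord_recl big_ord1 /cofactor !det_mx11 !mxE.
rewrite expr0 expr1 mul1r mulN1r mulrN.
by congr (A _ _ * A _ _ - A _ _ * A _ _); apply: val_inj.
Qed.

Theorem lemma5p3 (R : realType) :
  exists (m n : nat) (pa pb pc : 'I_m * 'I_n) (S : seq (affine_constraint m n)),
    [/\ (0 < m)%N /\ (0 < n)%N,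
        [/\ pa <> pb, pa <> pc & pb <> pc],
        (forall X : 'M[R]_(m, n),
           satisfies_all S X -> (\rank X <= 3)%N ->
           entry X pc = entry X pa * entry X pb)
      & (forall a b c : R, c = a * b ->
           exists X : 'M[R]_(m, n),
             [/\ (\rank X <= 3)%N, satisfies_all S X &
                 [/\ entry X pa = a, entry X pb = b & entry X pc = c]])].
Proof.
pose pos (i j : 'I_2) : 'I_(2 + 2) * 'I_(2 + 2) := (lshift 2 i, lshift 2 j).
(* The zeros of [T] at the three designated positions are placeholders: [F] excludes these
   positions, so no constraint fixes them. *)
pose T : 'M[rat]_(2 + 2) := block_mx (delta_mx 0 0) 0 0 1%:M.
pose F := predC (mem [:: pos 0 1; pos 1 0; pos 1 1]).
exists (2 + 2)%N, (2 + 2)%N, (pos 0 1), (pos 1 0), (pos 1 1), (prescribe T F).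
split=> // [X /satisfies_prescribe XT rX | a b c ->].
  have X00 : X (lshift 2 0) (lshift 2 0) = 1.
    by rewrite XT // block_mxEul mxE rmorph1.
  have Xur : ursubmx X = 0.
    apply/matrixP=> i j; rewrite !mxE XT ?block_mxEur ?mxE ?rmorph0 //.
    (* The designated positions all lie in the left columns, so every entry of the upper-right block
       is constrained. *)
    by rewrite /= !inE !xpair_eqE !eq_rlshift !andbF.
  have Xdr : drsubmx X = 1%:M.
    by apply/matrixP=> i j; rewrite !mxE XT ?block_mxEdr ?mxE ?rmorph_nat.
  (* Rank at most 3 in size 4 forces a zero determinant. Since [X] is block lower triangular with
     lower-right block the identity, its determinant is that of the upper-left block, which has
     corner 1: this is [c - a * b] in the designated entries. *)
  have := mxrank_lt_det0 (rX : (\rank X < 2 + 2)%N).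
  rewrite -[X in \det X]submxK Xur Xdr det_lblock det1 mulr1 det_mx2 !mxE X00.
  by rewrite mul1r => /eqP; rewrite subr_eq0 => /eqP.
(* When [c = a * b], the upper-left block is the outer product of (1, b) and (1, a), so its rank is
   at most 1. *)
pose u : 'cV[R]_2 := \col_i (if i == 0 then 1 else b).
pose v : 'rV[R]_2 := \row_j (if j == 0 then 1 else a).
exists (block_mx (u *m v) 0 0 1%:M); split.
- by rewrite rank_diag_block_mx mxrank1 (leq_add2r 2 _ 1) mulmx_max_rank.
- apply/satisfies_prescribe=> i j.
  case: (split_ordP i) => {}i ->; case: (split_ordP j) => {}j -> Fij.
  + rewrite !block_mxEul !mxE big_ord1 !mxE.
    move: Fij; rewrite /= !inE !xpair_eqE !eq_lshift.
    (* Of the four positions in this block, [F] keeps only the corner, where the product is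
       [1 * 1]. *)
    case: i => [[|[|//]] ?]; case: j => [[|[|//]] ?] //= _.
    by rewrite mulr1 rmorph1.
  + by rewrite !block_mxEur !mxE rmorph0.
  + by rewrite !block_mxEdl !mxE rmorph0.
  + by rewrite !block_mxEdr !mxE rmorph_nat.
- rewrite /entry /= !block_mxEul !mxE !big_ord1 !mxE /=.
  by rewrite mul1r mulr1 mulrC.
Qed.
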